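(* Let $d,r\in\mathbb{N}$, $\epsilon\in(0,1)$, let $\mathcal{H}$ be an $r$-set of rooted digraphs, and for $n\in\mathbb{N}$ let $P_{\mathcal{H}_n}$ be the set of $n$-vertex digraphs of the $F(d)$-model that are $\mathcal{H}$-free. Let $P=\bigcup_nP_n$ be a digraph property in the $F(d)$-model ($P_n$ its $n$-vertex members) such that for every $n$: (a) $P_n\subseteq P_{\mathcal{H}_n}$, and (b) $P_{\mathcal{H}_n}$ is $\epsilon/2$-close to $P_n$. Then $P$ is $1$-sided error $\epsilon$-strongly-testable in the $F(d)$-model.
   Context: The $F(d)$-model consists of all digraphs (no multiple edges) with every out-degree at most $d$. A query to an $n$-vertex digraph specifies a vertex $v$ and returns the set $\Gamma^+(v)$ of out-neighbours of $v$. A digraph property is a set of digraphs closed under isomorphism. $G$ is $\mathcal{H}$-free if it has no subgraph isomorphic to a member of $\mathcal{H}$. For $n$-vertex digraphs $G,G'$ of the model, $\mathrm{dist}(G,G')$ is the number of edge deletions/insertions turning $G$ into $G'$; $G$ is $\epsilon$-far from $G'$ if $\mathrm{dist}>\epsilon dn$, otherwise $\epsilon$-close; $G$ is $\epsilon$-close to a set if $\epsilon$-close to some member; two sets are $\epsilon$-close if every graph in each is $\epsilon$-close to the other. A $1$-sided error $\epsilon$-test for $P$ accepts every $n$-vertex digraph in $P$ with probability $1$ and rejects every $n$-vertex digraph $\epsilon$-far from $P_n$ with probability at least $1/2$. $P$ is $1$-sided error $\epsilon$-strongly-testable if it has a $1$-sided error $\epsilon$-test whose number of queries on every $n$-vertex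 input is bounded by a quantity depending only on $\epsilon$ (not on $n$). An $r$-set is a set of digraphs each with at most $r$ vertices. A component of a digraph is the subdigraph induced by a connected component of the underlying undirected graph; a digraph is rooted if each component has a vertex from which all its vertices are reachable by directed paths within the component. *)

(* Defs.v *)
From mathcomp Require Import all_boot all_order all_algebra.
From mathcomp Require Import classical_sets reals.

Set Implicit Arguments.
Unset Strict Implicit.
Unset Printing Implicit Defensive.

Import Order.TTheory GRing.Theory Num.Theory.
Local Open Scope ring_scope.

(* A digraph on the vertex set {0, ..., n-1}, given by its set of edges
   (u, v) = u -> v.  Loops and antiparallel edges are allowed, multiple edges
   are not.  A loop counts towards the out-degree. *)
Definition digraph (n : nat) := {set 'I_n * 'I_n}.

Definition arc n (G : digraph n) : rel 'I_n := fun u v => (u, v) \in G.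

Definition out_nbrs n (G : digraph n) (v : 'I_n) : {set 'I_n} :=
  [set w | arc G v w]%SET.

Definition F_model (d n : nat) : set (digraph n) :=
  fun G => forall v, (#|out_nbrs G v| <= d)%N.

(* [E] is read here as the edge set of a digraph whose vertex set is [S]
   (which may be smaller than 'I_n); its edges must have both ends in [S]. *)
Definition subgraph n (S : {set 'I_n}) (E : digraph n) (G : digraph n) : Prop :=
  (E \subset finset.setX S S) /\ (E \subset G).

(* [K] is isomorphic to the digraph with vertex set [S] and edge set [E]. *)
Definition isomorphic k n (K : digraph k) (S : {set 'I_n}) (E : digraph n)
    : Prop :=
  exists f : 'I_k -> 'I_n,
    [/\ injective f, (f @: [set: 'I_k])%SET = S
      & forall u v, arc K u v = arc E (f u) (f v)].

(* A set of digraphs, sorted by number of vertices. *)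
Definition digraph_set := forall n, set (digraph n).

Definition iso_closed (P : digraph_set) : Prop :=
  forall n (G G' : digraph n),
    isomorphic G [set: 'I_n]%SET G' -> P n G -> P n G'.

Definition F_property (d : nat) (P : digraph_set) : Prop :=
  (forall n, (P n `<=` F_model d (n := n))%classic) /\ iso_closed P.

Definition H_free (H : digraph_set) n (G : digraph n) : Prop :=
  forall k (K : digraph k), H k K ->
    ~ exists S E, subgraph S E G /\ isomorphic K S E.

Definition P_free (d : nat) (H : digraph_set) : digraph_set :=
  fun n G => F_model d G /\ H_free H G.
Arguments P_free d H n G : clear implicits.

Definition r_set (r : nat) (H : digraph_set) : Prop :=
  forall k (K : digraph k), H k K -> (k <= r)%N.

Definition underlying n (G : digraph n) : rel 'I_n :=
  fun u v => arc G u v || arc G v u.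

Definition component n (G : digraph n) (x : 'I_n) : {set 'I_n} :=
  [set y | connect (underlying G) x y]%SET.

Definition induced n (G : digraph n) (C : {set 'I_n}) : digraph n :=
  [set e in G | (e.1 \in C) && (e.2 \in C)]%SET.

Definition rooted n (G : digraph n) : Prop :=
  forall x : 'I_n, exists2 root, root \in component G x &
    forall y, y \in component G x ->
      connect (arc (induced G (component G x))) root y.

Definition dist n (G G' : digraph n) : nat :=
  #|(G :\: G')%SET| + #|(G' :\: G)%SET|.

Section Closeness.
Variable R : realType.

Definition far (eps : R) (d : nat) n (G G' : digraph n) : Prop :=
  eps * d%:R * n%:R < (dist G G')%:R.

Definition close (eps : R) (d : nat) n (G G' : digraph n) : Prop :=
  ~ far eps d G G'.

(* In particular every digraph is far from the empty set. *)
Definition close_to_set (eps : R) (d : nat) n (G : digraph n)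
    (A : set (digraph n)) : Prop :=
  exists2 G', A G' & close eps d G G'.

Definition far_from_set (eps : R) (d : nat) n (G : digraph n)
    (A : set (digraph n)) : Prop :=
  ~ close_to_set eps d G A.

Definition sets_close (eps : R) (d : nat) n (A B : set (digraph n)) : Prop :=
  (forall G, A G -> close_to_set eps d G B) /\
  (forall G, B G -> close_to_set eps d G A).

End Closeness.

(* Deterministic adaptive algorithms for n-vertex inputs, as decision trees:
   [Query v k] asks for the out-neighbourhood of [v] and continues according
   to the answer. *)
Inductive query_alg (n : nat) : Type :=
| Answer of bool
| Query of 'I_n & ({set 'I_n} -> query_alg n).

Fixpoint accepts n (G : digraph n) (A : query_alg n) : bool :=
  match A with
  | Answer b => b
  | Query v k => accepts G (k (out_nbrs G v))
  end.

Fixpoint nb_queries n (G : digraph n) (A : query_alg n) : nat :=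
  match A with
  | Answer _ => 0%N
  | Query v k => (nb_queries G (k (out_nbrs G v))).+1
  end.

(* A randomized algorithm is a probability distribution on deterministic ones.
   Finite support is no restriction: for fixed n and a fixed bound on the
   number of queries there are, up to their behaviour on n-vertex inputs of the
   model, only finitely many deterministic algorithms. *)
Record rand_alg (R : realType) (n : nat) := RandAlg {
  coins : finType;
  weight : coins -> R;
  weight_ge0 : forall w, 0 <= weight w;
  weight_sum1 : \sum_w weight w = 1;
  run : coins -> query_alg n }.

Definition prob_accept (R : realType) n (T : rand_alg R n) (G : digraph n) : R :=
  \sum_(w : coins T | accepts G (run w)) weight w.

Definition prob_reject (R : realType) n (T : rand_alg R n) (G : digraph n) : R :=
  \sum_(w : coins T | ~~ accepts G (run w)) weight w.

Definition one_sided_test (R : realType) (d : nat) (eps : R) (P : digraph_set)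
    (T : forall n, rand_alg R n) : Prop :=
  forall n (G : digraph n), F_model d G ->
    (P n G -> prob_accept (T n) G = 1) /\
    (far_from_set eps d G (P n) -> 1 / 2%:R <= prob_reject (T n) G).

(* The bound [q] may depend on d, eps and P, but not on n. *)
Definition one_sided_strongly_testable (R : realType) (d : nat) (eps : R)
    (P : digraph_set) : Prop :=
  exists (q : nat) (T : forall n, rand_alg R n),
    one_sided_test d eps P T /\
    forall n (G : digraph n), F_model d G ->
      forall w : coins (T n), (nb_queries G (run w) <= q)%N.

(* Main.v *)
Require Import Defs.
From mathcomp Require Import all_boot all_order all_algebra.
From mathcomp Require Import classical_sets reals.
From mathcomp Require Import boolp zify ring lra.
From mathcomp Require Import fintype finset.
Import Defs.

(* The test samples vertices, explores their out-balls of radius r, and accepts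
   iff the edges seen form an H-free digraph; it never rejects a member of P
   because H-freeness is inherited by subdigraphs.

   If G is eps-far from P then it is (eps/2)-far from being H-free. For each K in
   H take a maximal family of copies of K in G with pairwise disjoint root sets;
   deleting the out-edges of all these roots makes G H-free, so one of the
   families has linear size. In-degrees are unbounded, hence its copies may
   overlap heavily. Fixing, one at a time, the positions of K that take the same
   value too often leaves a family, still of linear size, in which every position
   is constant or takes each value rarely. Choosing one member of the family
   independently for each component of K, with probability at least 1/2 the
   chosen components do not collide and form a copy of K. Since the roots are
   pairwise distinct, a constant fraction of the r-tuples of vertices consists of
   the roots of such a choice, and constantly many random r-tuples suffice. *)

Set Implicit Arguments.
Unset Strict Implicit.
Unset Printing Implicit Defensive.

Import Order.TTheory GRing.Theory Num.Theory.
Local Open Scope nat_scope.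
Local Open Scope set_scope.

(** * Copies as embeddings, and heredity of H-freeness *)

Definition embeds k n (K : digraph k) (G : digraph n) (f : 'I_k -> 'I_n) : Prop :=
  injective f /\ forall u v, arc K u v -> arc G (f u) (f v).

Lemma H_freeP (H : digraph_set) n (G : digraph n) :
  H_free H G <-> forall k (K : digraph k), H k K -> forall f, ~ embeds K G f.
Proof.
split=> [free k K HK f [f_inj fG] | free k K HK [S [E [[_ sEG] [f [f_inj _ fE]]]]]].
  apply: (free k K HK); exists (f @: setT), [set (f e.1, f e.2) | e in K].
  split; first split.
  - by apply/subsetP=> _ /imsetP[e _ ->]; apply/setXP; rewrite !imset_f ?inE.
  - by apply/subsetP=> _ /imsetP[[u v] uvK ->]; apply: fG.
  exists f; split=> // u v; rewrite /arc; apply/idP/imsetP => [uvK | [[u' v'] uvK]].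
    by exists (u, v).
  by case=> /f_inj-> /f_inj->.
apply: (free k K HK f); split=> // u v; rewrite fE; exact: (subsetP sEG).
Qed.

Lemma H_free_sub (H : digraph_set) n (G G' : digraph n) :
  G' \subset G -> H_free H G -> H_free H G'.
Proof.
move=> sG'G /H_freeP free; apply/H_freeP=> k K HK f [f_inj fG'].
by apply: (free k K HK f); split=> // u v /fG'; apply: (subsetP sG'G).
Qed.

(** * Out-balls and their exploration by queries *)

Definition out_edges n (G : digraph n) (S : {set 'I_n}) : digraph n :=
  [set e in G | e.1 \in S].

Lemma card_out_edges d n (G : digraph n) (S : {set 'I_n}) :
  F_model d G -> #|out_edges G S| <= d * #|S|.
Proof.
move=> Gd; rewrite -sum1_card (partition_big fst (mem S)) /=; last first.
  by move=> e; rewrite inE => /andP[].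
rewrite mulnC -sum_nat_const; apply: leq_sum => v vS.
rewrite sum1dep_card; apply: leq_trans (Gd v).
have snd_inj : {in [set e | (e \in out_edges G S) && (e.1 == v)] &, injective snd}.
  by move=> [x y] [x' y']; rewrite !inE /= => /andP[_ /eqP->] /andP[_ /eqP->] ->.
rewrite -(card_in_imset snd_inj); apply/subset_leq_card/subsetP=> _ /imsetP[[x y] + ->].
by rewrite !inE /= => /andP[/andP[xyG _] /eqP<-].
Qed.

(** Its [t]-th iterate is the set of vertices reached from [S] by directed paths with at most [t]
    arcs. *)
Definition step n (G : digraph n) (S : {set 'I_n}) : {set 'I_n} :=
  S :|: snd @: out_edges G S.

Lemma iter_step_path n (G : digraph n) (S : {set 'I_n}) x p t :
  x \in S -> path (arc G) x p -> size p <= t -> last x p \in iter t (step G) S.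
Proof.
elim: t S x p => [|t IHt] S x [|y p] //= xS.
  by move=> _ _; rewrite -iterS iterSr; apply: (IHt _ x [::]) => //; rewrite inE xS.
case/andP=> xy yp szp; rewrite -iterS iterSr; apply: IHt => //.
by rewrite inE; apply/orP; right; apply/imsetP; exists (x, y) => //; rewrite inE /= xS andbT.
Qed.

Lemma iter_step_connect k n (K : digraph k) (G : digraph n) f (S : {set 'I_n}) x u t :
  embeds K G f -> connect (arc K) x u -> f x \in S -> k <= t ->
  f u \in iter t (step G) S.
Proof.
move=> [_ fG] /connectP[p0 Kp0 ->] fxS kt.
case/shortenP: Kp0 => p Kp /= /andP[_ p_uniq] _.
rewrite -last_map; apply: iter_step_path => //.
  by elim: p x Kp {fxS p_uniq} => //= y p IHp x /andP[/fG-> /IHp].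
rewrite size_map (leq_trans _ kt) // -[k in _ <= k]card_ord.
by rewrite -(card_uniqP p_uniq) max_card.
Qed.

Fixpoint query_all n (s : seq 'I_n) (E : digraph n)
    (cont : digraph n -> query_alg n) : query_alg n :=
  if s is v :: s' then
    Query v (fun N => query_all s' (E :|: [set (v, w) | w in N]) cont)
  else cont E.

(** Each round queries the whole current set afresh. This costs at most a factor [t.+1], and the
    last round hands [dec] exactly the out-edges of the final ball. *)
Fixpoint explore n (t : nat) (S : {set 'I_n}) (dec : digraph n -> bool) : query_alg n :=
  query_all (enum S) set0 (fun E =>
    if t is t'.+1 then explore t' (S :|: snd @: E) dec else Answer n (dec E)).

Lemma query_allE n (G : digraph n) (s : seq 'I_n) E cont :
  let E' := E :|: out_edges G [set v in s] in
  accepts G (query_all s E cont) = accepts G (cont E') /\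
  nb_queries G (query_all s E cont) = size s + nb_queries G (cont E').
Proof.
elim: s E => [|v s IHs] E /=.
  suff -> : E :|: out_edges G [set v in [::]] = E by [].
  by apply/setP=> e; rewrite !inE andbF orbF.
have [-> ->] := IHs (E :|: [set (v, w) | w in out_nbrs G v]); rewrite addSn.
suff -> : E :|: [set (v, w) | w in out_nbrs G v] :|: out_edges G [set x in s]
          = E :|: out_edges G [set x in v :: s] by [].
apply/setP=> -[x y]; rewrite !inE /= -orbA; congr (_ || _).
have -> : ((x, y) \in [set (v, w) | w in out_nbrs G v]) = ((x, y) \in G) && (x == v).
  apply/imsetP/andP => [[w] | [xyG /eqP<-]]; first by rewrite inE => vw [-> ->].
  by exists y; rewrite ?inE.
by rewrite andb_orr.
Qed.

Lemma exploreE n (G : digraph n) t S dec :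
  accepts G (explore t S dec) = dec (out_edges G (iter t (step G) S)).
Proof.
elim: t S => [|t IHt] S; rewrite [explore _ _ _]/= (query_allE G _ _ _).1 /=.
  by rewrite set0U set_enum.
by rewrite IHt set0U set_enum -iterS iterSr.
Qed.

Lemma nb_queries_explore d n (G : digraph n) t S dec : F_model d G ->
  nb_queries G (explore t S dec) <= t.+1 * (d.+1 ^ t * #|S|).
Proof.
move=> Gd; elim: t S => [|t IHt] S; rewrite [explore _ _ _]/= (query_allE G _ _ _).2 -cardE /=.
  by rewrite addn0 expn0 !mul1n.
rewrite set0U set_enum; apply: leq_trans (leq_add (leqnn _) (IHt _)) _.
have le1 : #|S :|: snd @: out_edges G S| <= d.+1 * #|S|.
  rewrite mulSn (leq_trans (leq_card_setU _ _)) // leq_add2l.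
  exact: leq_trans (leq_imset_card _ _) (card_out_edges _ Gd).
rewrite [t.+2 * _]mulSn; apply: leq_add; first by rewrite leq_pmull // expn_gt0.
by rewrite leq_mul2l expnSr -mulnA leq_mul2l le1 !orbT.
Qed.

(** * Roots of the components *)

(* [c] labels components and [R] picks a root for each label. The labels of
   edgeless components (and unused labels) are given some vertex with out-edges:
   the packing argument below separates copies by deleting the out-edges of all
   the vertices [R p]. *)
Definition root_labelling r k (K : digraph k) (c : 'I_k -> 'I_r) (R : 'I_r -> 'I_k) :=
  (forall u v, arc K u v -> c u = c v /\ connect (arc K) (R (c u)) u) /\
  (forall p, exists v, arc K (R p) v).

Lemma root_labelling_exists r k (K : digraph k) :
  rooted K -> k <= r -> K != set0 -> exists c (R : 'I_r -> 'I_k), root_labelling K c R.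
Proof.
move=> Krooted kr /set0Pn[[u0 v0] uv0].
have und_sym : connect_sym (underlying K).
  by apply: sym_connect_sym => u v; rewrite /underlying orbC.
pose c u := widen_ord kr (fingraph.root (underlying K) u).
have c_eq u v : c u = c v -> connect (underlying K) u v.
  by move=> /(congr1 val) /= /val_inj/(fingraph.rootP und_sym).
have /fin_all_exists[R RP] : forall p : 'I_r, exists x : 'I_k,
    (exists v, arc K x v) /\ forall u v, c u = p -> arc K u v -> connect (arc K) x u.
  move=> p; have [|none] := boolP [exists u, exists v, (c u == p) && arc K u v].
    case/existsP=> u /existsP[v /andP[/eqP cup uv]].
    have [x xu Rx] := Krooted u.
    have Kx u' : c u' = p -> connect (arc K) x u'.
      rewrite -cup => /esym/c_eq uu'; have: u' \in component K u by rewrite inE.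
      move=> /Rx; apply: connect_sub => y z yz; apply: connect1.
      by move: yz; rewrite /arc inE => /andP[].
    exists x; split=> [|u' v' cu' _]; last exact: Kx.
    (* The path from [x] to [u] is empty, and then the arc from [u] to [v] starts at [x], or its
       first arc does. *)
    have /connectP[[/= _ ux|y q /= /andP[xy _] _]] := Kx u cup; last by exists y.
    by exists v; rewrite -ux.
  exists u0; split=> [|u v cu uv]; first by exists v0.
  by case/negP: none; apply/existsP; exists u; apply/existsP; exists v; rewrite cu eqxx.
exists c, R; split=> [u v uv | p]; last exact: (RP p).1.
split; last exact: (RP _).2 uv.
by congr widen_ord; apply/(fingraph.rootP und_sym)/connect1; rewrite /underlying uv.
Qed.

(** * Spread families and tuples of their members *)

(* Each coordinate of [F'] is constant or spread out: as long as some value is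
   taken too often by a coordinate, restrict to the functions taking it. *)
Lemma spread_subfamily (A V : finType) (B : nat) (F : {set {ffun A -> V}}) : 0 < B ->
  exists2 F' : {set {ffun A -> V}}, F' \subset F &
    #|F| <= B ^ #|A| * #|F'| /\
    forall a, {in F' &, forall f g : {ffun A -> V}, f a = g a} \/
              (forall w, B * #|[set f in F' | f a == w]| <= #|F'|).
Proof.
move=> B0.
(* [X] holds the coordinates already made constant. Each restriction adds one to them and costs a
   factor [B]. *)
suff: forall m (X : {set A}) (F : {set {ffun A -> V}}),
    #|~: X| <= m -> (forall a, a \in X -> {in F &, forall f g : {ffun A -> V}, f a = g a}) ->
  exists2 F' : {set {ffun A -> V}}, F' \subset F &
    #|F| <= B ^ m * #|F'| /\
    forall a, {in F' &, forall f g : {ffun A -> V}, f a = g a} \/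
              (forall w, B * #|[set f in F' | f a == w]| <= #|F'|).
  by move/(_ _ set0 F); apply; [rewrite setC0 cardsT | move=> a; rewrite inE].
elim=> [|m IHm] X {}F leXm constX.
  exists F => //; split=> [|a]; first by rewrite mul1n.
  left; apply: constX; move: leXm; rewrite leqn0 cards_eq0 => /eqP XC0.
  by have := in_set0 a; rewrite -XC0 inE => /negbFE.
have [/existsP[a /andP[aX /existsP[w ltFw]]]|none] := boolP
  [exists a, (a \notin X) && [exists w, #|F| < B * #|[set f in F | f a == w]|]]; last first.
  exists F => //; split=> [|a]; first by rewrite leq_pmull // expn_gt0 B0.
  have [/constX|aX] := boolP (a \in X); first by left.
  right=> w; rewrite leqNgt; apply: contra none => ltFw.
  by apply/existsP; exists a; rewrite aX; apply/existsP; exists w.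
have [||F' sF' [leF' spreadF']] := IHm (a |: X) [set f in F | f a == w].
- by move: leXm; rewrite [#|~: X|](cardsD1 a) inE aX setCU setIC -setDE.
- move=> b /setU1P[-> | bX] f g; rewrite !inE => /andP[fF /eqP fw] /andP[gF /eqP gw].
    by rewrite fw gw.
  exact: constX.
exists F'; first by apply: subset_trans sF' _; apply/subsetP=> f; rewrite inE => /andP[].
split=> //; rewrite expnS -mulnA; apply: leq_trans (ltnW ltFw) _.
by rewrite leq_mul2l leF' orbT.
Qed.

(** Once the value [g] at [q] is fixed, at most [#|F| / N] values remain at [p]; the other
    coordinates range freely over [F]. *)
Lemma card_tuples_related (I T : finType) (F : {set T}) (bad : rel T) N (p q : I) :
  p != q -> {in F, forall g, N * #|[set f in F | bad f g]| <= #|F|} ->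
  N * #|[set i : {ffun I -> T} | (i \in ffun_on (mem F)) && bad (i p) (i q)]| <= #|F| ^ #|I|.
Proof.
move=> pq badN; set S := [set i | _].
have -> : #|F| ^ #|I| = \sum_(g in F) \prod_(x : I | x != q) #|F|.
  have -> : #|F| ^ #|I| = \prod_(x : I) #|F| by rewrite prod_nat_const.
  by rewrite sum_nat_const (bigD1 q).
rewrite -sum1_card (partition_big (fun i : {ffun I -> T} => i q) (mem F)) /=; last first.
  by move=> i; rewrite inE => /andP[/ffun_onP].
rewrite big_distrr /=; apply: leq_sum => g gF; rewrite sum1dep_card.
pose D x := if x == q then [set g] else if x == p then [set f in F | bad f g] else F.
have le1 : #|[set i | (i \in S) && (i q == g)]| <= #|family (fun x => mem (D x))|.
  apply/subset_leq_card/subsetP=> i; rewrite !inE => /andP[/andP[/ffun_onP iF bi] /eqP iq].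
  apply/familyP=> x; rewrite /D; case: eqP => [->|_]; first by rewrite iq inE.
  by case: eqP => [->|_]; rewrite ?inE ?iF //= -iq.
apply: leq_trans (leq_mul (leqnn N) le1) _.
rewrite card_family foldrE big_map big_enum /= (bigD1 q) //= /D eqxx cards1 mul1n.
rewrite (bigD1 p) //= (negPf pq) eqxx mulnA [leqRHS](bigD1 p) //=.
apply: leq_mul; first exact: badN.
by apply: leq_prod => x /andP[/negPf-> /negPf->].
Qed.

Lemma leq_card_bigcup (I T : finType) (P : pred I) (S : I -> {set T}) :
  #|\bigcup_(x | P x) S x| <= \sum_(x | P x) #|S x|.
Proof.
elim/big_ind2: _ => [|S1 s1 S2 s2 le1 le2|//]; first by rewrite cards0.
exact: leq_trans (leq_card_setU _ _) (leq_add le1 le2).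
Qed.

(** Union bound over the ordered pairs [(p, q)]: at most [#|I| ^ 2] of them, each spoiling a
    fraction at most [1 / N] of the tuples. *)
Lemma card_tuples_unrelated (I T : finType) (F : {set T}) (bad : rel T) N :
  2 * (#|I| ^ 2).+1 <= N ->
  {in F, forall g, N * #|[set f in F | bad f g]| <= #|F|} ->
  #|F| ^ #|I| <= 2 * #|[set i : {ffun I -> T} | (i \in ffun_on (mem F)) &&
                        [forall p, forall q, (p != q) ==> ~~ bad (i p) (i q)]]|.
Proof.
move=> leN badN; set good := [set i | _].
pose badpq (e : I * I) :=
  [set i : {ffun I -> T} | (i \in ffun_on (mem F)) && bad (i e.1) (i e.2)].
have le1 : #|F| ^ #|I| <= #|good| + \sum_(e | e.1 != e.2) #|badpq e|.
  rewrite -(card_ffun_on I (mem F)) -leq_subLR.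
  apply: leq_trans (leq_card_bigcup _ _); rewrite leq_subLR; apply: leq_trans (leq_card_setU _ _).
  apply/subset_leq_card/subsetP=> i iF; rewrite inE.
  have [//|] := boolP (i \in good); rewrite inE iF /= => /forallPn[p /forallPn[q]].
  rewrite negb_imply negbK => /andP[pq bpq].
  by apply/bigcupP; exists (p, q); rewrite // inE iF.
have le2 : N * (\sum_(e | e.1 != e.2) #|badpq e|) <= #|I| ^ 2 * #|F| ^ #|I|.
  rewrite big_distrr /=; apply: leq_trans (_ : \sum_(e : I * I) #|F| ^ #|I| <= _).
    rewrite [leqRHS](bigID (fun e : I * I => e.1 != e.2)) /=.
    by apply: leq_trans (leq_addr _ _); apply: leq_sum => e ne; apply: card_tuples_related ne badN.
  by rewrite sum_nat_const card_prod mulnn.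
set s := \sum_(e | _) _ in le1 le2; set M := _ ^ #|I| in le1 le2 *.
have : 2 * (#|I| ^ 2).+1 * s <= #|I| ^ 2 * M by apply: leq_trans le2; rewrite leq_mul2r leN orbT.
by move: (#|I| ^ 2) => x; nia.
Qed.

(** * Packing copies with disjoint root sets *)

(* In a maximal family of copies with pairwise disjoint root sets, every other
   copy has a root in common with the family. *)
Lemma root_packing r k (K : digraph k) n (G : digraph n) c (R : 'I_r -> 'I_k) :
  root_labelling K c R -> K != set0 ->
  exists F : {set {ffun 'I_k -> 'I_n}},
    [/\ {in F, forall f : {ffun 'I_k -> 'I_n}, embeds K G f},
        forall p, {in F &, injective (fun f : {ffun 'I_k -> 'I_n} => f (R p))} &
        exists2 D : {set 'I_n}, #|D| <= r * #|F| &
          forall f, embeds K G f -> exists a b, arc K a b /\ f a \in D].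
Proof.
move=> [lc lR] /set0Pn[[u0 v0] _].
pose valid (F : {set {ffun 'I_k -> 'I_n}}) :=
  [forall f in F, `[< embeds K G f >]] &&
  [forall f in F, forall h in F, (f != h) ==> [forall p, forall q, f (R p) != h (R q)]].
have [F /maxsetP[/andP[/forall_inP Femb /forall_inP Fdis] Fmax]] : {F | maxset valid F}.
  by apply: ex_maxset; exists set0; apply/andP; split; apply/forall_inP=> f; rewrite inE.
have {}Fdis f h p q : f \in F -> h \in F -> f (R p) = h (R q) -> f = h.
  move=> fF hF fh; apply/eqP; apply: contraTT (introT eqP fh) => neq.
  by have /forall_inP/(_ h hF)/implyP/(_ neq)/forallP/(_ p)/forallP/(_ q) := Fdis f fF.
exists F; split=> [f /Femb/asboolP // | p f h fF hF /= | ]; first exact: Fdis.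
exists [set (e.1 : {ffun 'I_k -> 'I_n}) (R e.2) | e in setX F [set: 'I_r]].
  by rewrite (leq_trans (leq_imset_card _ _)) // cardsX cardsT card_ord mulnC.
set D := [set _ | _ in _] => f femb.
suff [p fpD] : exists p, f (R p) \in D by have [b Rb] := lR p; exists (R p), b.
apply/existsP; apply: contraT => /existsPn fD.
pose g := [ffun a => f a].
have gf : g =1 f by move=> a; rewrite ffunE.
have FgF : g |: F = F.
  apply: Fmax; last exact: subsetUr.
  apply/andP; split; apply/forall_inP=> h1 /setU1P h1F.
    case: h1F => [-> | /Femb //]; apply/asboolP; case: femb => f_inj fG.
    by split=> [a b | a b /fG]; rewrite !gf // => /f_inj.
  apply/forall_inP=> h2 /setU1P h2F; apply/implyP=> neq.
  apply/forallP=> p; apply/forallP=> q; move: neq; apply: contraNN => /eqP.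
  have inD h s : h \in F -> h (R s) \in D.
    by move=> hF; apply/imsetP; exists (h, s); rewrite // inE hF inE.
  case: h1F h2F => [-> | h1F] [-> | h2F] //.
  - by rewrite gf => fh; have := fD p; rewrite fh inD.
  - by rewrite gf => fh; have := fD q; rewrite -fh inD.
  - by move/(Fdis _ _ _ _ h1F h2F)->.
have gF : g \in F by rewrite -FgF setU11.
have := fD (c u0); rewrite -gf; case/negP.
by apply/imsetP; exists (g, c u0); rewrite // inE gF inE.
Qed.

Lemma dist_triangle n (G1 G2 G3 : digraph n) : dist G1 G3 <= dist G1 G2 + dist G2 G3.
Proof.
have tri (A B C : digraph n) : #|A :\: C| <= #|A :\: B| + #|B :\: C|.
  apply: leq_trans (leq_card_setU _ _); apply/subset_leq_card/subsetP=> e.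
  by rewrite !inE; case: (e \in A); case: (e \in B); case: (e \in C).
by rewrite /dist; have := tri G1 G2 G3; have := tri G3 G2 G1; lia.
Qed.

Definition nb_digraphs r := #|{: {k : 'I_r.+1 & {set 'I_k * 'I_k}}}|.

(** Otherwise each of the at most [nb_digraphs r] members of [H] has a set [D] of at most
    [n / (E * nb_digraphs r)] vertices containing the tail of an arc of every copy. Deleting the
    out-edges of the union of these sets costs at most [d * n / E] edges and makes [G] H-free. *)
Lemma dense_packing d r E n (H : digraph_set) (G : digraph n) :
  F_model d G -> r_set r H -> (forall k (K : digraph k), H k K -> rooted K) ->
  H_free H (set0 : digraph n) ->
  (forall G' : digraph n, F_model d G' -> H_free H G' -> d * n < E * dist G G') ->
  exists k (K : digraph k) c (R : 'I_r -> 'I_k) (F : {set {ffun 'I_k -> 'I_n}}),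
    [/\ H k K /\ k <= r, root_labelling K c R,
        {in F, forall f : {ffun 'I_k -> 'I_n}, embeds K G f},
        forall p, {in F &, injective (fun f : {ffun 'I_k -> 'I_n} => f (R p))} &
        n <= E * nb_digraphs r * r * #|F|].
Proof.
move=> Gd Hr Hroot /H_freeP free0 Gfar; apply: contrapT => none.
pose T := {k : 'I_r.+1 & {set 'I_k * 'I_k}}.
have /fin_all_exists[D DP] : forall t : T, exists D : {set 'I_n},
    E * nb_digraphs r * #|D| <= n /\
    (H _ (tagged t : digraph _) -> forall f, embeds (tagged t : digraph _) G f ->
       exists a b, arc (tagged t : digraph _) a b /\ f a \in D).
  case=> k K /=; have [HK | nHK] := pselect (H k K); last first.
    by exists set0; rewrite cards0 muln0.
  (* An edgeless member with a copy in [G] would also have one in the empty digraph, which [free0]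
     excludes. *)
  have [K0 | K0] := eqVneq K set0.
    exists set0; rewrite cards0 muln0; split=> // _ f [f_inj _]; case: (free0 k K HK f).
    by split=> // u v; rewrite K0 /arc inE.
  have kr : k <= r by rewrite -ltnS.
  have [c [R KcR]] := root_labelling_exists (Hroot k K HK) kr K0.
  have [F [Femb Finj [D leD DP]]] := root_packing G KcR K0.
  exists D; split; last by [].
  have [leF | ltF] := leqP n (E * nb_digraphs r * r * #|F|).
    by case: none; exists k, K, c, R, F; split.
  by rewrite (leq_trans _ (ltnW ltF)) // -[leqRHS]mulnA leq_mul2l leD orbT.
pose U := \bigcup_t D t.
pose G' : digraph n := G :\: out_edges G U.
have G'd : F_model d G'.
  move=> v; apply: leq_trans (Gd v); apply/subset_leq_card/subsetP=> w.
  by rewrite !inE /arc inE => /andP[].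
have G'free : H_free H G'.
  apply/H_freeP=> k K HK f [f_inj fG'].
  have kr : k < r.+1 by rewrite ltnS (Hr k K).
  have [|a [b [/fG' + faD]]] := (DP (Tagged (fun k : 'I_r.+1 => {set 'I_k * 'I_k})
      (K : {set 'I_(Ordinal kr) * 'I_(Ordinal kr)}))).2 HK f.
    by split=> // u v /fG'; rewrite /arc inE => /andP[].
  rewrite /arc !inE /= => /andP[+ fab]; rewrite fab /= => /negP; apply.
  by apply/bigcupP; eexists; last exact: faD.
have := Gfar G' G'd G'free; rewrite ltnNge => /negP; apply.
have -> : dist G G' = #|out_edges G U|.
  rewrite /dist /G' setDDr setDv set0U (setIidPr _); last first.
    by apply/subsetP=> e; rewrite inE => /andP[].
  have -> : G :\: out_edges G U :\: G = set0; last by rewrite cards0 addn0.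
  by apply/eqP; rewrite setD_eq0 subsetDl.
apply: leq_trans (leq_mul (leqnn E) (card_out_edges U Gd)) _.
rewrite mulnCA leq_mul2l; apply/orP; right.
apply: leq_trans (leq_mul (leqnn E) (leq_card_bigcup _ _)) _.
have T0 : 0 < nb_digraphs r.
  apply/card_gt0P; exists (Tagged (fun k : 'I_r.+1 => {set 'I_k * 'I_k})
    (set0 : {set 'I_(ord0 : 'I_r.+1) * _})).
  by [].
rewrite -(leq_pmul2l T0) mulnA [_ * E]mulnC big_distrr /=.
apply: leq_trans (_ : \sum_(t : T) n <= _); last by rewrite sum_nat_const.
by apply: leq_sum => t _; apply: (DP t).1.
Qed.

(** * Gluing components of different copies *)

(* Copies of the components of [K] taken from different members of a spread
   family glue together: a constant position is shared by all members, and a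
   light position rarely collides with another member. *)
Lemma many_samples r k n (K : digraph k) (G : digraph n) c (R : 'I_r -> 'I_k)
    (F : {set {ffun 'I_k -> 'I_n}}) M (B := 2 * (r ^ 2).+1 * (r ^ 2).+1) :
  k <= r -> root_labelling K c R ->
  {in F, forall f : {ffun 'I_k -> 'I_n}, embeds K G f} ->
  (forall p, {in F &, injective (fun f : {ffun 'I_k -> 'I_n} => f (R p))}) ->
  n <= M * #|F| ->
  n ^ r <= 2 * (M * B ^ r) ^ r * #|[set x : {ffun 'I_r -> 'I_n} |
    `[< forall S : {set 'I_n}, (forall p, x p \in S) ->
          exists f, embeds K (out_edges G (iter r (step G) S)) f >]]|.
Proof.
(* [S] may be any set containing the tuple, since exploration starts from all sampled tuples at
   once. *)
move=> kr [lc lR] Femb Finj leF; set good := [set x | _].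
have [|F' sF' [leF' spreadF']] := @spread_subfamily _ _ B F; first by rewrite /B !muln_gt0.
pose light a := [forall w, B * #|[set f in F' | f a == w]| <= #|F'|].
pose bad (f h : {ffun 'I_k -> 'I_n}) := [exists a, exists b, light a && (f a == h b)].
(* One factor [(r ^ 2).+1] of [B] pays for the pairs of positions [(a, b)], the remaining
   [2 * (r ^ 2).+1] for the pairs of labels. *)
have badN : {in F', forall h,
    2 * (r ^ 2).+1 * #|[set f in F' | bad f h]| <= #|F'|}.
  move=> h hF; rewrite -(leq_pmul2l (ltn0Sn (r ^ 2))) mulnA [_ * (2 * _)]mulnC.
  have sub : [set f in F' | bad f h] \subset
      \bigcup_(e : 'I_k * 'I_k | light e.1) [set f in F' | f e.1 == h e.2].
    apply/subsetP=> f; rewrite inE => /andP[fF /existsP[a /existsP[b /andP[la fh]]]].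
    by apply/bigcupP; exists (a, b); rewrite // inE fF.
  apply: leq_trans (leq_mul (leqnn _) (subset_leq_card sub)) _.
  apply: leq_trans (leq_mul (leqnn _) (leq_card_bigcup _ _)) _.
  rewrite big_distrr /=; apply: leq_trans (_ : \sum_(e : 'I_k * 'I_k) #|F'| <= _).
    rewrite [leqRHS](bigID (fun e : 'I_k * 'I_k => light e.1)) /=.
    by apply: leq_trans (leq_addr _ _); apply: leq_sum => e /forallP/(_ (h e.2)).
  rewrite sum_nat_const card_prod card_ord leq_mul2r (leq_trans _ (leqnSn _)) ?orbT //.
  by rewrite leq_mul.
have := @card_tuples_unrelated 'I_r _ F' bad (2 * (r ^ 2).+1).
rewrite card_ord => /(_ (leqnn _) badN); set tuples := [set i | _] => le_tuples.
pose sample (i : {ffun 'I_r -> {ffun 'I_k -> 'I_n}}) := [ffun p => i p (R p)].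
have sample_inj : {in tuples &, injective sample}.
  move=> i j; rewrite !inE => /andP[/ffun_onP iF _] /andP[/ffun_onP jF _] eq_ij.
  apply/ffunP=> p; apply: (Finj p); rewrite ?(subsetP sF') ?iF ?jF //.
  by have := congr1 (fun x : {ffun 'I_r -> 'I_n} => x p) eq_ij; rewrite /sample !ffunE.
have sub_good : sample @: tuples \subset good.
  apply/subsetP=> _ /imsetP[i + ->].
  rewrite !inE => /andP[/ffun_onP iF unrel]; apply/asboolP=> S iS.
  have iG p : embeds K G (i p) by apply/Femb/(subsetP sF').
  have reach u v : arc K u v -> i (c u) u \in iter r (step G) S.
    move=> /lc[_ conn]; apply: iter_step_connect (iG _) conn _ kr.
    by have := iS (c u); rewrite ffunE.
  exists (fun a => i (c a) a); split=> [a b eq_ab | u v uv]; last first.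
    have [cuv _] := lc u v uv; rewrite /arc inE (reach u v) // andbT -cuv.
    exact: (iG (c u)).2.
  (* Injectivity: within a component a single copy is used; a constant position [a] may be read in
     the copy chosen for [b]; a light one would make the two copies [bad]. *)
  have [eq_c | neq_c] := eqVneq (c a) (c b).
    by apply: (iG (c b)).1; rewrite -eq_ab eq_c.
  have [fixed | la] := spreadF' a.
    apply: (iG (c b)).1; rewrite -eq_ab; exact: fixed.
  have /forallP/(_ (c a))/forallP/(_ (c b)) := unrel; rewrite neq_c => /negP[].
  by apply/existsP; exists a; apply/existsP; exists b; rewrite eq_ab eqxx andbT; apply/forallP.
have le_good : #|F'| ^ r <= 2 * #|good|.
  apply: leq_trans le_tuples _; rewrite leq_mul2l /= -(card_in_imset sample_inj).
  exact: subset_leq_card.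
rewrite [2 * _]mulnC -mulnA; apply: leq_trans (leq_mul (leqnn _) le_good).
rewrite -expnMn; have mono a b : a <= b -> a ^ r <= b ^ r.
  by case: (r) => // r' ab; rewrite leq_exp2r.
apply: mono; apply: leq_trans leF _; rewrite -mulnA leq_mul2l; apply/orP; right.
apply: leq_trans leF' _; rewrite card_ord leq_mul2r; apply/orP; right.
by rewrite leq_pexp2l // /B !muln_gt0.
Qed.

(** * Repeated sampling *)

(** Bernoulli's inequality for [1 + 1 / m], cleared of denominators. *)
Lemma pow_pred_half m : 2 * m ^ m.+1 <= m.+1 ^ m.+1.
Proof.
case: m => // m; set a := m.+1.
have bernoulli j : a ^ j * (a + j) <= a * a.+1 ^ j.
  elim: j => [|j IHj]; first by rewrite !expn0 addn0 mul1n muln1.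
  rewrite !expnS; move: (a ^ j) (a.+1 ^ j) IHj => x y; nia.
rewrite -(leq_pmul2l (ltn0Sn m)) -/a; apply: leq_trans (bernoulli a.+1).
by rewrite mulnCA mulnA mulnC leq_mul2l; apply/orP; right; rewrite mul2n -addnn leq_add2l.
Qed.

(** Each draw hits [good] with probability at least [1 / D], so all [D] draws miss with probability
    at most [(1 - 1 / D) ^ D], hence at most one half. *)
Lemma card_always_miss (T : finType) (good : {set T}) D : 0 < #|T| -> #|T| <= D * #|good| ->
  2 * #|[set w : {ffun 'I_D -> T} | [forall l, w l \notin good]]| <= #|{ffun 'I_D -> T}|.
Proof.
case: D => [|m]; first by rewrite mul0n leqn0 => /prednK <-.
move=> _ leT; set miss := [set w | _].
have -> : #|miss| = #|~: good| ^ m.+1.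
  rewrite -[in RHS](card_ord m.+1) -card_ffun_on; apply: eq_card => w; rewrite inE.
  by apply/forallP/ffun_onP => wP l; have := wP l; rewrite inE.
rewrite card_ffun card_ord.
have leC : m.+1 * #|~: good| <= m * #|T| by have := cardsC good; nia.
rewrite -(@leq_pmul2l (m.+1 ^ m.+1)) ?expn_gt0 // mulnCA -expnMn.
apply: leq_trans (leq_mul (leqnn 2) (_ : _ <= (m * #|T|) ^ m.+1)) _.
  by rewrite leq_exp2r.
by rewrite expnMn mulnA leq_mul2r pow_pred_half orbT.
Qed.

(** * The tester and its rejection probability *)

Section Tester.
Variables (R : realType) (H : digraph_set) (r L : nat).

(* ['I_n.-1.+1] rather than ['I_n] so that there are coins for n = 0 as well. *)
Definition samples n := {ffun 'I_L -> {ffun 'I_r -> 'I_n.-1.+1}}.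

Definition sampled n (w : samples n) : {set 'I_n} :=
  \bigcup_(e : 'I_L * 'I_r) [set v | val v == val (w e.1 e.2)].

Definition uniform_weight n (w : samples n) : R := (#|{: samples n}|%:R^-1)%R.

Lemma uniform_weight_ge0 n (w : samples n) : (0 <= uniform_weight w)%R.
Proof. by rewrite invr_ge0 ler0n. Qed.

Lemma card_samples_gt0 n : 0 < #|{: samples n}|.
Proof. by rewrite card_ffun expn_gt0 card_ffun expn_gt0 !card_ord. Qed.

Lemma uniform_weight_sum1 n : (\sum_(w : samples n) uniform_weight w = 1)%R.
Proof.
rewrite /uniform_weight sumr_const -[LHS]mulr_natl divff // pnatr_eq0 -lt0n.
exact: card_samples_gt0.
Qed.

Definition tester n : rand_alg R n :=
  RandAlg (@uniform_weight_ge0 n) (@uniform_weight_sum1 n)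
    (fun w => explore r (sampled w) (fun E => `[< H_free H E >])).

Lemma card_sampled n (w : samples n) : #|sampled w| <= L * r.
Proof.
apply: leq_trans (leq_card_bigcup _ _) _.
apply: leq_trans (_ : \sum_(e : 'I_L * 'I_r) 1 <= _); last first.
  by rewrite sum1_card card_prod !card_ord.
apply: leq_sum => e _; apply/card_le1_eqP => u v; rewrite !inE => /eqP uE /eqP vE.
by apply: val_inj; rewrite uE vE.
Qed.

Lemma prob_reject_half n (G : digraph n) (miss : {set samples n}) :
  2 * #|miss| <= #|{: samples n}| ->
  (forall w, w \notin miss -> ~~ accepts G (run (r := tester n) w)) ->
  (1 / 2%:R <= prob_reject (tester n) G)%R.
Proof.
move=> le_miss reject; have N0 := card_samples_gt0 n.
apply: (@le_trans _ _ (\sum_(w in ~: miss) uniform_weight w)%R); last first.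
  rewrite /prob_reject [leRHS](bigID (mem (~: miss))) /= -[leLHS]addr0.
  apply: lerD; last by apply: sumr_ge0 => w _; apply: uniform_weight_ge0.
  rewrite le_eqVlt; apply/orP; left; apply/eqP/eq_bigl => w.
  by rewrite inE; case: (boolP (w \in miss)) => [|/reject->]; rewrite ?andbF.
rewrite /uniform_weight sumr_const -[leRHS]mulr_natl ler_pdivlMr ?ltr0n //.
rewrite mulrAC ler_pdivrMr ?ltr0n //.
rewrite mul1r -natrM ler_nat; move: le_miss; rewrite -(cardsC miss); lia.
Qed.

End Tester.

(** * From farness to rejection *)

Local Open Scope ring_scope.

Theorem theorem4p4 (R : realType) (d r : nat) (eps : R)
    (heps : 0 < eps < 1)
    (H : digraph_set) (hr : r_set r H)
    (hroot : forall k (K : digraph k), H k K -> rooted K)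
    (P : digraph_set) (hP : F_property d P)
    (ha : forall n, (P n `<=` P_free d H n)%classic)
    (hb : forall n, sets_close (eps / 2%:R) d (P_free d H n) (P n)) :
  one_sided_strongly_testable d eps P.
Proof.
have [eps0 _] := andP heps.
(* A natural number above [2 / eps], which turns farness into an inequality between naturals. *)
pose E := Num.bound (eps / 2%:R)^-1.
have E1 : 1 <= eps / 2%:R * E%:R.
  rewrite -ler_pdivrMl ?divr_gt0 // mulr1; apply/ltW/archi_boundP.
  by rewrite invr_ge0 divr_ge0 // ltW.
(* Inverse densities: the packed family has at least [n / M] members, and at least [n ^ r / L] root
   tuples are good. *)
pose M := (E * nb_digraphs r * r)%N.
pose L := (2 * (M * (2 * (r ^ 2).+1 * (r ^ 2).+1) ^ r) ^ r)%N.
exists (r.+1 * (d.+1 ^ r * (L * r)))%N, (tester R H r L); split; last first.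
  move=> n G Gd w; apply: leq_trans (nb_queries_explore _ _ _ Gd) _.
  by rewrite !leq_mul ?card_sampled.
move=> n G Gd; split=> [PG | Gfar].
  rewrite -(weight_sum1 (tester R H r L n)); apply: eq_bigl => w /=.
  rewrite exploreE; apply/asboolP; apply: H_free_sub _ (ha _ _ PG).2.
  by apply/subsetP=> e; rewrite inE => /andP[].
(* If even the empty digraph contains a member of [H], every [n]-vertex digraph does, and the tester
   always rejects. *)
have [free0 | nfree0] := pselect (H_free H (set0 : digraph n)); last first.
  apply: (@prob_reject_half _ _ _ _ _ _ set0); first by rewrite cards0.
  move=> w _; rewrite exploreE; apply/asboolPn => free; apply: nfree0.
  by apply: H_free_sub _ free; apply: sub0set.
(* By (b), an H-free [G'] within [eps / 2] of [G] would bring a member of [P] within [eps]. *)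
have {}Gfar (G' : digraph n) : F_model d G' -> H_free H G' -> (d * n < E * dist G G')%N.
  move=> G'd G'free; have [G2 PG2 close2] := (hb n).1 G' (conj G'd G'free).
  have far1 : far (eps / 2%:R) d G G'.
    apply: contrapT => close1; apply: Gfar; exists G2 => // far2.
    have tri := dist_triangle G G' G2.
    move: close1 close2 far2; rewrite /close /far => /negP + /negP.
    rewrite -!leNgt => le1 le2; apply/negP; rewrite -leNgt.
    apply: (@le_trans _ _ (dist G G' + dist G' G2)%:R); first by rewrite ler_nat.
    by rewrite natrD; lra.
  move: far1; rewrite /far -(ltr_nat R) !natrM.
  have E0 : 0 < E%:R :> R by move: E1; case: (E) => // ; rewrite mulr0 ler10.
  move=> far1.
  apply: (@le_lt_trans _ _ (E%:R * (eps / 2%:R * d%:R * n%:R))); last by rewrite ltr_pM2l.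
  have -> : E%:R * (eps / 2%:R * d%:R * n%:R) = eps / 2%:R * E%:R * (d%:R * n%:R) by ring.
  by rewrite ler_peMl // mulr_ge0.
(* For [n = 0] farness is impossible; for a successor, coins and vertices have the same type. *)
case: n G Gd free0 Gfar => [|n] G Gd free0 Gfar.
  have G0 : G = set0 by apply/setP=> -[[]].
  have : (d * 0 < E * dist G set0)%N by apply: Gfar => // -[].
  by rewrite /dist G0 setDv cards0 !muln0.
have [k [K [c [rho [F [[HK kr] KcR Femb Finj leF]]]]]] := dense_packing Gd hr hroot free0 Gfar.
have := many_samples kr KcR Femb Finj leF; rewrite -/M -/L; set good := [set x | _].
move=> many.
apply: (@prob_reject_half _ _ _ _ _ _
  [set w : samples r L n.+1 | [forall l, w l \notin good]]) => [|w].
  by apply: card_always_miss; rewrite card_ffun !card_ord // expn_gt0.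
rewrite inE => /forallPn[l]; rewrite negbK inE => /asboolP wlP.
rewrite exploreE; apply/asboolPn => /H_freeP free.
have [|f femb] := wlP (sampled w); last exact: free k K HK f femb.
by move=> p; apply/bigcupP; exists (l, p) => //; rewrite inE.
Qed.
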